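(* There is an absolute constant $c > 0$ such that the following holds. Let $n, p \ge 1$, $0 < \varepsilon \le 1/2$, $\delta \ge 0$, and suppose the renormalized multi-processor cup game on $n$ cups with parameters $p,\varepsilon,\delta$ is played for $m \le e^{\varepsilon^2 p/12}$ steps. Then there is a (randomized) emptier algorithm which guarantees, against every oblivious filler, that with probability at least $1 - e^{-c\varepsilon^2 p}$ the backlog is at most $1$ at the end of every one of the $m$ steps.
   Context: Renormalized multi-processor cup game with parameters $p,\varepsilon,\delta$: $n$ cups, initially empty; in each step the filler pours nonnegative amounts $c_j(i) \le 1$ with $\sum_j c_j(i) \le (1-\varepsilon)p$, then the emptier selects up to $p+1$ distinct cups and removes up to $1+2\delta$ units from each. The filler is oblivious (amounts fixed in advance, independent of the emptier's randomness). The backlog is the maximum fill of any cup. *)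

(* Defs.v *)
From HB Require Import structures.
From mathcomp Require Import all_boot all_order all_algebra.
From mathcomp Require Import all_classical all_reals all_analysis.

Set Implicit Arguments.
Unset Strict Implicit.
Unset Printing Implicit Defensive.

Import Order.TTheory GRing.Theory Num.Theory.
Local Open Scope ring_scope.

(* [c i j] is the amount poured into cup [j] in step [i]; steps are numbered
   from 0.  An oblivious filler is such a sequence, fixed in advance. *)
Definition filler (R : realType) (n : nat) := nat -> 'I_n -> R.

Definition legal_filler (R : realType) (n p : nat) (eps : R) (m : nat)
    (c : filler R n) : Prop :=
  forall i, (i < m)%N ->
    (forall j, 0 <= c i j <= 1) /\ \sum_(j < n) c i j <= (1 - eps) * p%:R.

(* A deterministic online emptier: it maps the pours seen so far, the current
   step's included, to the amounts removed in the current step.  Since the past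
   removals are a function of the past pours, this is full information about
   the state of the game. *)
Definition strategy (R : realType) (n : nat) :=
  seq ('I_n -> R) -> 'I_n -> R.

Definition removal (R : realType) (n : nat) (s : strategy R n) (c : filler R n)
    (i : nat) : 'I_n -> R :=
  s (mkseq c i.+1).

(* Fill of cup [j] once [i] steps have been completed. *)
Fixpoint fill (R : realType) (n : nat) (s : strategy R n) (c : filler R n)
    (i : nat) (j : 'I_n) : R :=
  if i is k.+1 then fill s c k j + c k j - removal s c k j else 0.

(* Fills are nonnegative for legal play, so the default value 0 is harmless. *)
Definition backlog (R : realType) (n : nat) (s : strategy R n) (c : filler R n)
    (i : nat) : R :=
  \big[Num.max/0]_(j < n) fill s c i j.

(* The cups selected in a step are those from which something is removed; no
   more can be removed from a cup than it holds after the pour. *)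
Definition legal_strategy (R : realType) (n p : nat) (eps delta : R) (m : nat)
    (s : strategy R n) : Prop :=
  forall c, legal_filler p eps m c -> forall i, (i < m)%N ->
    (#|[set j | removal s c i j != 0%R]| <= p.+1)%N /\
    (forall j, [/\ 0 <= removal s c i j,
                   removal s c i j <= 1 + 2 * delta
                 & removal s c i j <= fill s c i j + c i j]).

(* A randomized emptier draws its random bits [w] once, independently of the
   filler.  Measurability makes the events about the game measurable. *)
Definition randomized_emptier (R : realType) (n p : nat) (eps delta : R)
    (m : nat) (d : measure_display) (T : measurableType d)
    (A : T -> strategy R n) : Prop :=
  (forall w, legal_strategy p eps delta m (A w)) /\
  (forall h j, measurable_fun setT (fun w => A w h j)).

(* Main.v *)
Require Import Defs.
From mathcomp Require Import all_boot all_order all_algebra.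
From mathcomp Require Import all_classical all_reals all_analysis.
From mathcomp Require Import zify ring lra.

Set Implicit Arguments.
Unset Strict Implicit.
Unset Printing Implicit Defensive.

Import Order.TTheory GRing.Theory Num.Theory.
Local Open Scope ring_scope.

(* Cup [j] gets a random phantom offset [x j / n], with [x j] uniform on
   [{0, ..., n - 1}] and independent over the cups, and is emptied (of at most
   one unit) exactly when offset plus total pour, the latter rounded down to a
   multiple of [1 / n], crosses an integer; if more than [p + 1] cups cross in
   one step, nothing is removed in that step.  As long as this never happens,
   the fill is at most the fractional part of offset plus rounded pour, plus
   the rounding error, hence at most 1.  A cup that receives [c] crosses with probability at
   most [c + 1 / n], so the expected number of crossings is at most
   [(1 - eps) p + 1], and the Chernoff bound with parameter [eps / 2] makes an
   overflow in a given step have probability at most [exp (- eps^2 p / 4)];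
   the union bound over [m <= exp (eps^2 p / 12)] steps leaves
   [exp (- eps^2 p / 6)]. *)

(** * Offsets for which an integer is crossed *)

(* Hermite's identity. *)
Lemma sum_divn_shift (N a : nat) :
  (0 < N)%N -> (\sum_(k < N) (k + a) %/ N = a)%N.
Proof.
move=> N0; elim: a => [|a IHa].
  by rewrite big1 // => k _; rewrite addn0 divn_small.
under eq_bigr do rewrite addnS -addSn.
(* Adding the term [a %/ N] gives a sum over [N + 1] consecutive values; dropping its last term
   [(N + a) %/ N] instead of its first changes the result by one. *)
apply/eqP; rewrite -(eqn_add2l (a %/ N)); apply/eqP.
rewrite -[X in (X %/ N + _)%N]add0n.
rewrite -(big_ord_recl N (fun k : 'I_N.+1 => (k + a) %/ N)%N).
by rewrite big_ord_recr /= IHa divnDl // divnn N0; lia.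
Qed.

(** Since [b <= a + N], each quotient grows by 0 or 1, so the count is the difference of Hermite's
    identity at [b] and at [a]. *)
Lemma card_crossing_offsets (N a b : nat) : (0 < N)%N -> (a <= b <= a + N)%N ->
  #|[set k : 'I_N | (k + a) %/ N < (k + b) %/ N]%N| = (b - a)%N.
Proof.
move=> N0 /andP[ab ba]; rewrite -sum1_card.
rewrite -[in RHS](sum_divn_shift b N0) -[in RHS](sum_divn_shift a N0).
rewrite -sumnB; last by move=> k _; rewrite leq_div2r// leq_add2l.
rewrite big_mkcond /=; apply: eq_bigr => k _; rewrite inE.
have h1 : ((k + a) %/ N <= (k + b) %/ N)%N by rewrite leq_div2r// leq_add2l.
have h2 : ((k + b) %/ N <= (k + a) %/ N + 1)%N.
  have -> : ((k + a) %/ N + 1 = (k + a + N) %/ N)%N.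
    by rewrite (divnDr _ (dvdnn N)) divnn N0.
  by rewrite leq_div2r//; lia.
by case: ifP; lia.
Qed.

(** * Chernoff bound and uniform law on a finite set *)

(** Exponential Markov inequality in counting form: the indicator of the event is at most
    [expR (t * (count - q))], whose sum over all [x] factors over the coordinates; each factor is
    bounded through [1 + u <= expR u]. *)
Lemma ffun_chernoff (R : realType) (n N q : nat) (D : 'I_n -> {set 'I_N}) (t : R) :
  (0 < N)%N -> 0 <= t ->
  #|[set x : {ffun 'I_n -> 'I_N} | q <= #|[set j | x j \in D j]|]%N|%:R
  <= expR ((expR t - 1) * (\sum_j #|D j|%:R / N%:R) - t * q%:R)
     * #|{ffun 'I_n -> 'I_N}|%:R.
Proof.
move=> N0 t0; rewrite expRD expRN [leRHS]mulrAC ler_pdivlMr ?expR_gt0//.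
have Npos : 0 < N%:R :> R by rewrite ltr0n.
pose F (j : 'I_n) (k : 'I_N) : R := if k \in D j then expR t else 1.
have F0 j k : 0 <= F j k by rewrite /F; case: ifP => // _; rewrite expR_ge0.
have prodF (x : {ffun 'I_n -> 'I_N}) :
    \prod_j F j (x j) = expR (t * #|[set j | x j \in D j]|%:R).
  rewrite [t * _]mulrC expRM_natl -big_mkcond /= prodr_const.
  by congr (_ ^+ _); apply: eq_card => j; rewrite inE.
apply: (@le_trans _ _ (\sum_(x : {ffun 'I_n -> 'I_N}) \prod_j F j (x j))).
  rewrite -sum1_card natr_sum mulr_suml [leLHS]big_mkcond /=.
  apply: ler_sum => x _; rewrite inE; case: ifP => [qx|_].
    by rewrite mul1r prodF ler_expR ler_wpM2l // ler_nat.
  by apply: prodr_ge0.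
rewrite -bigA_distr_bigA card_ffun !card_ord natrX mulr_sumr expR_sum.
rewrite -[X in _ ^+ X](card_ord n) -prodr_const -big_split /=.
apply: ler_prod => j _; rewrite sumr_ge0 //=.
have -> : \sum_k F j k = N%:R * (1 + (expR t - 1) * (#|D j|%:R / N%:R)).
  transitivity (\sum_(k < N) (1 + (expR t - 1) * (k \in D j)%:R)).
    by apply: eq_bigr => k _; rewrite /F; case: (k \in D j) => /=; ring.
  rewrite big_split /= -mulr_sumr sumr_const card_ord -natr_sum.
  have -> : (\sum_(k < N) (k \in D j))%N = #|D j|.
    by rewrite -sum1_card [RHS]big_mkcond; apply: eq_bigr => k _; case: (k \in D j).
  by field; rewrite gt_eqF.
by rewrite mulrC ler_wpM2r ?ler0n// expR_ge1Dx.
Qed.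

(* The uniform law on [Om], realized on [nat], whose sigma-algebra is discrete. *)
Lemma finite_uniform (R : realType) (Om : finType) (w0 : Om) :
  exists (P : probability nat R) (X : nat -> Om),
    forall E : {set Om}, P (fun t => X t \in E) = (#|E|%:R / #|Om|%:R)%:E.
Proof.
have Om0 : (0 < #|Om|)%N by apply/card_gt0P; exists w0.
(* Counting measure on the first [#|Om|] naturals, to be normalized; [X] reads off the enumeration
   of [Om]. The Dirac mass at [0] is the fallback of [mnormalize] for total mass zero or
   infinity. *)
pose mu : {measure set nat -> \bar R} := msum (fun k => @dirac _ nat k R) #|Om|.
exists (mnormalize mu (@dirac _ nat 0%N R)), (nth w0 (enum Om)) => E.
have muE (A : pred nat) :
    mu (fun t => A t) = (\sum_(k < #|Om|) (A k)%:R : R)%:E.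
  rewrite /mu /msum -sumEFin; apply: eq_bigr => k _.
  rewrite /= diracE; congr (_%:R%:E).
  by congr nat_of_bool; exact: asboolb.
have muT : mu setT = #|Om|%:R%:E.
  have -> : @setT nat = (fun t => predT t) by apply/funext => t; apply/propext.
  by rewrite (muE predT) sumr_const card_ord.
rewrite /= /mnormalize; case: ifP => [|_].
  by rewrite muT eqe pnatr_eq0 orbF eqn0Ngt Om0.
rewrite (muE (fun t => nth w0 (enum Om) t \in E)) muT /= -EFinM.
congr (_ / _)%:E.
rewrite -natr_sum; congr _%:R.
rewrite -[RHS]sum1_card [RHS]big_mkcond /= -[RHS]big_enum /=.
rewrite (big_nth w0) big_mkord -cardE; apply: eq_bigr => k _.
by case: (_ \in E).
Qed.

(** * The emptier *)

Definition poured (R : realType) (n : nat) (c : filler R n) (i : nat) (j : 'I_n) : R :=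
  \sum_(k < i) c k j.

(* The total pour in units of [1 / N], rounded down. *)
Definition ticks (R : realType) (n N : nat) (c : filler R n) (i : nat) (j : 'I_n) : nat :=
  Num.truncn (N%:R * poured c i j).

Definition wraps (R : realType) (n N : nat) (x : 'I_n -> nat) (c : filler R n)
    (i : nat) (j : 'I_n) : nat :=
  ((x j + ticks N c i j) %/ N)%N.

Definition wrapping (R : realType) (n N : nat) (x : 'I_n -> nat) (c : filler R n)
    (i : nat) : {set 'I_n} :=
  [set j | (wraps N x c i j < wraps N x c i.+1 j)%N].

(** The minimum with [f] keeps the removal legal: a crossing cup may hold less than one unit, as its
    phantom offset is not real content. *)
Definition emptied (R : realType) (n p : nat) (X : {set 'I_n}) (f : R) (j : 'I_n) : R :=
  if (#|X| <= p.+1)%N && (j \in X) then Num.min 1 f else 0.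

(** The fill under [wrap_strategy], computed from the pours alone so that the strategy can refer to
    it without circularity. *)
Fixpoint level (R : realType) (n p N : nat) (x : 'I_n -> nat) (c : filler R n)
    (i : nat) (j : 'I_n) : R :=
  if i is k.+1 then
    let f := level p N x c k j + c k j in f - emptied p (wrapping N x c k) f j
  else 0.

(** A nonempty history ends with the current step, of index [(size h).-1]; no later pour is read. *)
Definition wrap_strategy (R : realType) (n p N : nat) (x : 'I_n -> nat) : strategy R n :=
  fun h j =>
    let c := nth (fun=> 0) h in let i := (size h).-1 in
    emptied p (wrapping N x c i) (level p N x c i j + c i j) j.

(** * Dependence on past pours only, and the actual fill *)

Lemma eq_ticks (R : realType) (n N : nat) (c c' : filler R n) (i : nat) :
  (forall k, (k < i)%N -> c k = c' k) -> ticks N c i =1 ticks N c' i.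
Proof.
move=> cc' j; rewrite /ticks /poured; congr (Num.truncn (_ * _)).
by apply: eq_bigr => k _; rewrite cc'.
Qed.

Lemma eq_wrapping (R : realType) (n N : nat) (x : 'I_n -> nat)
    (c c' : filler R n) (i : nat) :
  (forall k, (k <= i)%N -> c k = c' k) -> wrapping N x c i = wrapping N x c' i.
Proof.
move=> cc'; apply/setP => j; rewrite !inE /wraps.
by rewrite (@eq_ticks _ _ _ c c' i) ?(@eq_ticks _ _ _ c c' i.+1) // => k /ltnW /cc'.
Qed.

Lemma eq_level (R : realType) (n p N : nat) (x : 'I_n -> nat)
    (c c' : filler R n) (i : nat) :
  (forall k, (k < i)%N -> c k = c' k) -> level p N x c i =1 level p N x c' i.
Proof.
elim: i => [//|i IHi] cc' j /=.
by rewrite (@eq_wrapping _ _ _ _ c c') // IHi ?cc' // => k /ltnW /cc'.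
Qed.

Lemma removal_wrap (R : realType) (n p N : nat) (x : 'I_n -> nat)
    (c : filler R n) (i : nat) (j : 'I_n) :
  removal (wrap_strategy p N x) c i j
  = emptied p (wrapping N x c i) (level p N x c i j + c i j) j.
Proof.
rewrite /removal /wrap_strategy size_mkseq /=.
have E k : (k <= i)%N -> nth (fun=> 0) (mkseq c i.+1) k = c k.
  by move=> ki; rewrite nth_mkseq.
by rewrite (eq_wrapping _ _ E) E // (@eq_level _ _ _ _ _ _ c) // => k /ltnW /E.
Qed.

Lemma fill_wrap (R : realType) (n p N : nat) (x : 'I_n -> nat)
    (c : filler R n) (i : nat) :
  fill (wrap_strategy p N x) c i =1 level p N x c i.
Proof. by elim: i => [//|i IHi] j /=; rewrite removal_wrap IHi. Qed.

Lemma emptied_bounds (R : realType) (n p : nat) (X : {set 'I_n}) (f : R) (j : 'I_n) :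
  0 <= f -> [/\ 0 <= emptied p X f j, emptied p X f j <= 1 & emptied p X f j <= f].
Proof.
move=> f0; rewrite /emptied; case: ifP => _; last by split.
by split; rewrite ?le_min ?ge_min ?lexx ?f0 ?ler01 ?orbT.
Qed.

Lemma card_emptied (R : realType) (n p : nat) (X : {set 'I_n}) (f : 'I_n -> R) :
  (#|[set j | emptied p X (f j) j != 0%R]| <= p.+1)%N.
Proof.
have [Xp|pX] := leqP #|X| p.+1.
  apply: leq_trans Xp; apply/subset_leq_card/fintype.subsetP => j.
  rewrite inE /emptied.
  by case: (j \in X); rewrite ?andbF ?eqxx.
by rewrite eq_card0 // => j; rewrite !inE /emptied leqNgt pX /= eqxx.
Qed.

(** * Invariants under legal pours *)

Section LegalFiller.
Context (R : realType) (n p : nat) (eps : R) (m : nat) (c : filler R n).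
Hypothesis legal_c : legal_filler p eps m c.

Lemma pour_bounds i j : (i < m)%N -> 0 <= c i j <= 1.
Proof. by move=> /legal_c[]. Qed.

Lemma level_ge0 q N x i j : (i <= m)%N -> 0 <= level q N x c i j.
Proof.
elim: i => [//|i IHi] im /=; rewrite subr_ge0.
have /andP[c0 _] := pour_bounds j im.
by have [] := @emptied_bounds _ _ q (wrapping N x c i) _ j (addr_ge0 (IHi (ltnW im)) c0).
Qed.

Lemma poured_ge0 i j : (i <= m)%N -> 0 <= poured c i j.
Proof.
move=> im; apply: sumr_ge0 => k _.
by have /andP[] := pour_bounds j (leq_trans (ltn_ord k) im).
Qed.

Lemma pouredS i j : poured c i.+1 j = poured c i j + c i j.
Proof. by rewrite /poured big_ord_recr. Qed.

Lemma ticks_itv N i j : (i <= m)%N ->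
  (ticks N c i j)%:R <= N%:R * poured c i j < (ticks N c i j)%:R + 1.
Proof.
move=> im; have := truncn_itv (mulr_ge0 (ler0n R N) (poured_ge0 j im)).
by rewrite -natr1.
Qed.

(** The difference of the two rounded totals exceeds [N * c i j <= N] by less than one; being an
    integer, it is at most [N]. *)
Lemma ticksS N i j : (i < m)%N ->
  [/\ (ticks N c i j <= ticks N c i.+1 j)%N,
      (ticks N c i.+1 j <= ticks N c i j + N)%N
    & ((ticks N c i.+1 j - ticks N c i j)%N%:R <= N%:R * c i j + 1)].
Proof.
move=> im; have /andP[c0 c1] := pour_bounds j im.
have /andP[lo hi] := ticks_itv N j (ltnW im).
have /andP[loS hiS] := ticks_itv N j im.
have Nc0 : 0 <= N%:R * c i j by rewrite mulr_ge0.
have Nc1 : N%:R * c i j <= N%:R by rewrite ler_piMr.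
have mono : (ticks N c i j <= ticks N c i.+1 j)%N.
  rewrite -ltnS -(ltr_nat R) -natr1 (le_lt_trans lo)// (le_lt_trans _ hiS)//.
  by rewrite pouredS mulrDr lerDl.
move: loS hiS; rewrite pouredS mulrDr => loS hiS; split=> //.
  rewrite -ltnS -(ltr_nat R) -natr1 natrD; lra.
by rewrite natrB //; lra.
Qed.

(* Without overflow the invariant is [N * level <= N * poured + x - N * wraps];
   the right-hand side is less than [N], being [(x + ticks) %% N] up to the
   rounding error of [ticks]. *)
Lemma level_le1 N x i j : (0 < N)%N -> (forall j, (x j < N)%N) ->
  (forall k, (k < m)%N -> (#|wrapping N x c k| <= p.+1)%N) -> (i <= m)%N ->
  level p N x c i j <= 1.
Proof.
move=> N0 xN small im; have Npos : 0 < N%:R :> R by rewrite ltr0n.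
have wrapsE k : (k <= m)%N ->
    0 <= N%:R * poured c k j + (x j)%:R - N%:R * (wraps N x c k j)%:R <= N%:R.
  move=> km; have /andP[lo hi] := ticks_itv N j km.
  have := divn_eq (x j + ticks N c k j) N; have := ltn_pmod (x j + ticks N c k j) N0.
  rewrite -/(wraps N x c k j); move: (_ %% _)%N => r.
  rewrite -(ler_nat R) -natr1 => rN /(congr1 (fun z => z%:R : R)).
  rewrite !natrD natrM => eqn.
  have r0 : 0 <= r%:R :> R by [].
  by apply/andP; split; lra.
suff inv : N%:R * level p N x c i j <=
    N%:R * poured c i j + (x j)%:R - N%:R * (wraps N x c i j)%:R.
  rewrite -(ler_pM2l Npos) mulr1 (le_trans inv) //.
  by have /andP[] := wrapsE i im.
elim: i im => [|i IHi] im /=.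
  by rewrite mulr0 /wraps /ticks /poured big_ord0 mulr0 truncn0 addn0 divn_small //.
have {}IHi := IHi (ltnW im).
(* For a crossing cup that holds at most one unit: its level drops to 0, and the invariant then asks
   that its right-hand side be nonnegative. *)
have /andP[vS0 _] := wrapsE i.+1 im.
have [t1 t2 _] := ticksS N j im.
have w1 : (wraps N x c i j <= wraps N x c i.+1 j)%N by rewrite leq_div2r // leq_add2l.
have w2 : (wraps N x c i.+1 j <= (wraps N x c i j).+1)%N.
  have : ((x j + ticks N c i.+1 j) %/ N <= (x j + ticks N c i j + N) %/ N)%N.
    by rewrite leq_div2r // -addnA leq_add2l.
  by rewrite (divnDr _ (dvdnn N)) divnn N0 addn1.
rewrite /emptied small //= inE.
move: vS0; rewrite pouredS.
case: ltnP => [w|w] vS0; last first.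
  have -> : wraps N x c i.+1 j = wraps N x c i j by apply/eqP; rewrite eqn_leq w.
  by rewrite subr0 !mulrDr; lra.
have wE : wraps N x c i.+1 j = (wraps N x c i j).+1 by apply/eqP; rewrite eqn_leq w2.
move: vS0; rewrite wE -natr1 !mulrDr mulr1 mulrN => vS0.
by rewrite /Num.min; case: ifP => _; rewrite ?mulr1 ?mulrDr; lra.
Qed.

(** The excess [N^-1] is the price of rounding; for [N = n] it adds up to one over all cups. *)
Lemma card_wrapping_offsets N i j : (0 < N)%N -> (i < m)%N ->
  #|[set k : 'I_N | (k + ticks N c i j) %/ N < (k + ticks N c i.+1 j) %/ N]%N|%:R / N%:R
  <= c i j + N%:R^-1.
Proof.
move=> N0 im; have [t1 t2 t3] := ticksS N j im.
have Npos : 0 < N%:R :> R by rewrite ltr0n.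
rewrite card_crossing_offsets ?t1 // ler_pdivrMr // mulrDl mulVf ?gt_eqF //.
by rewrite [c i j * _]mulrC.
Qed.

End LegalFiller.

(** * Overflow probability in one step *)

Lemma wrapping_tail (R : realType) (n p : nat) (eps : R) (m : nat)
    (c : filler R n) (i : nat) :
  (0 < n)%N -> 0 < eps -> eps <= 1 / 2 -> legal_filler p eps m c -> (i < m)%N ->
  #|[set x : {ffun 'I_n -> 'I_n} | p.+1 < #|wrapping n (fun j => x j) c i|]%N|%:R
  <= expR (- (eps ^+ 2 * p%:R / 4)) * #|{ffun 'I_n -> 'I_n}|%:R :> R.
Proof.
move=> n0 e0 e2 legal_c im.
pose D j := [set k : 'I_n | (k + ticks n c i j) %/ n < (k + ticks n c i.+1 j) %/ n]%N.
have t0 : 0 <= eps / 2 by lra.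
have -> : [set x : {ffun 'I_n -> 'I_n} | p.+1 < #|wrapping n (fun j => x j) c i|]%N
    = [set x : {ffun 'I_n -> 'I_n} | p.+2 <= #|[set j | x j \in D j]|]%N.
  apply/setP => x; rewrite !inE; congr (_ < _)%N.
  by apply: eq_card => j; rewrite !inE.
apply: le_trans (ffun_chernoff p.+2 D n0 t0) _.
rewrite ler_wpM2r // ler_expR.
have sumD : \sum_j #|D j|%:R / n%:R <= (1 - eps) * p%:R + 1.
  apply: le_trans (_ : _ <= \sum_(j < n) (c i j + n%:R^-1)) _.
    by apply: ler_sum => j _; exact: card_wrapping_offsets legal_c _ _ _ n0 im.
  rewrite big_split /= sumr_const card_ord -[_ *+ n]mulr_natr.
  rewrite mulVf ?pnatr_eq0 -?lt0n //.
  by rewrite lerD2r; have [] := legal_c i im.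
(* [expR t <= 1 / (1 - t)] at [t = eps / 2] *)
have expt : expR (eps / 2) - 1 <= eps / (2 - eps).
  rewrite lerBlDr -[eps / 2]opprK expRN.
  have -> : eps / (2 - eps) + 1 = (1 + - (eps / 2))^-1 by field; lra.
  by rewrite lef_pV2 ?posrE ?expR_gt0 ?expR_ge1Dx//; lra.
have p0 : 0 <= p%:R :> R by [].
have q0 : 0 <= (1 - eps) * p%:R + 1 by rewrite addr_ge0 // mulr_ge0 //; lra.
apply: le_trans (_ : _ <= eps / (2 - eps) * ((1 - eps) * p%:R + 1)
                          - eps / 2 * p.+2%:R) _.
  rewrite lerD2r (le_trans (ler_wpM2l _ sumD)) ?ler_wpM2r //.
  by rewrite subr_ge0 -[leLHS]expR0 ler_expR.
rewrite -[p.+2]addn2 natrD.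
(* The part free of [p] and the coefficient of [p] are nonnegative separately; the 2 in [p + 2] pays
   for the extra one in the mean. *)
suff : 0 <= eps / 2 * 2 - eps / (2 - eps)
     + p%:R * (eps / 2 - eps ^+ 2 / 4 - eps / (2 - eps) * (1 - eps)) by lra.
rewrite addr_ge0 ?mulr_ge0 //.
  have -> : eps / 2 * 2 - eps / (2 - eps) = eps * (1 - eps) / (2 - eps) by field; lra.
  by rewrite divr_ge0 ?mulr_ge0 //; lra.
have -> : eps / 2 - eps ^+ 2 / 4 - eps / (2 - eps) * (1 - eps)
    = eps ^+ 3 / 4 / (2 - eps) by field; lra.
by rewrite !divr_ge0 ?exprn_ge0 //; lra.
Qed.

(** * Legality, union bound and conclusion *)

Lemma legal_wrap_strategy (R : realType) (n p N : nat) (eps delta : R) (m : nat)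
    (x : 'I_n -> nat) :
  0 <= delta -> legal_strategy p eps delta m (wrap_strategy p N x : strategy R n).
Proof.
move=> d0 c legal_c i im; split.
  rewrite (_ : [set j | _] = [set j | emptied p (wrapping N x c i)
      (level p N x c i j + c i j) j != 0%R]); first exact: card_emptied.
  by apply/setP => j; rewrite !inE removal_wrap.
move=> j; rewrite removal_wrap fill_wrap.
have /andP[c0 _] := pour_bounds legal_c j im.
have [e0 e1 ef] := emptied_bounds p (wrapping N x c i) j
  (addr_ge0 (level_ge0 legal_c p N x j (ltnW im)) c0).
by split=> //; apply: le_trans e1 _; lra.
Qed.

Lemma backlog_wrap_le1 (R : realType) (n p : nat) (eps : R) (m : nat) (c : filler R n)
    (N : nat) (x : 'I_n -> nat) :
  legal_filler p eps m c -> (0 < N)%N -> (forall j, (x j < N)%N) ->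
  (forall i, (i < m)%N -> (#|wrapping N x c i| <= p.+1)%N) ->
  forall i, (i < m)%N -> backlog (wrap_strategy p N x) c i.+1 <= 1.
Proof.
move=> legal_c N0 xN small i im; apply: bigmax_le => // j _.
by rewrite fill_wrap (level_le1 legal_c).
Qed.

Lemma card_no_overflow (R : realType) (n p : nat) (eps : R) (m : nat)
    (c : filler R n) :
  (0 < n)%N -> 0 < eps -> eps <= 1 / 2 -> legal_filler p eps m c ->
  (1 - m%:R * expR (- (eps ^+ 2 * p%:R / 4))) * #|{ffun 'I_n -> 'I_n}|%:R
  <= #|[set x : {ffun 'I_n -> 'I_n} |
        [forall i : 'I_m, #|wrapping n (fun j => x j) c i| <= p.+1]%N]|%:R :> R.
Proof.
move=> n0 e0 e2 legal_c; set E := [set x | _].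
pose B (i : 'I_m) := [set x : {ffun 'I_n -> 'I_n} |
  p.+1 < #|wrapping n (fun j => x j) c i|]%N.
have EC : (~: E)%SET \subset (\bigcup_i B i)%SET.
  apply/fintype.subsetP => x; rewrite !inE negb_forall => /existsP[i].
  rewrite -ltnNge => xi.
  by apply/bigcupP; exists i; rewrite ?inE.
have CB : #|(~: E)%SET|%:R
    <= m%:R * expR (- (eps ^+ 2 * p%:R / 4)) * #|{ffun 'I_n -> 'I_n}|%:R :> R.
  apply: le_trans (_ : _ <= (\sum_(i < m) #|B i|)%:R) _.
    rewrite ler_nat (leq_trans (subset_leq_card EC)) //.
    elim/big_rec2: _ => [|i k U _ kU]; first by rewrite cards0.
    by rewrite (leq_trans (leq_card_setU _ _).1) // leq_add2l.
  rewrite natr_sum -[leRHS]mulrA mulr_natl -[X in _ *+ X]card_ord -sumr_const.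
  by apply: ler_sum => i _; exact: (wrapping_tail n0 e0 e2 legal_c).
have := cardsC E; move/(congr1 (fun k => k%:R : R)); rewrite natrD => CE; lra.
Qed.

Local Open Scope classical_set_scope.
Local Open Scope ring_scope.

Theorem theorem6p2 (R : realType) :
  exists K : R, 0 < K /\
  forall (n p : nat) (eps delta : R) (m : nat),
    (1 <= n)%N -> (1 <= p)%N -> 0 < eps -> eps <= 1 / 2 -> 0 <= delta ->
    m%:R <= expR (eps ^+ 2 * p%:R / 12) ->
    exists (d : measure_display) (T : measurableType d) (P : probability T R)
           (A : T -> strategy R n),
      randomized_emptier p eps delta m A /\
      forall c : filler R n, legal_filler p eps m c ->
        ((1 - expR (- (K * eps ^+ 2 * p%:R)))%:E
          <= P [set w | forall i, (i < m)%N -> (backlog (A w) c i.+1 <= 1)%R])%E.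
Proof.
(* [1 / 6 = 1 / 4 - 1 / 12]: the exponent of the tail in one step less that of the number of
   steps. *)
exists (1 / 6); split=> [|n p eps delta m n0 _ e0 e2 d0 mle]; first by lra.
have [P [X PX]] := finite_uniform R [ffun _ : 'I_n => Ordinal n0].
exists default_measure_display, nat, P, (fun w => wrap_strategy p n (fun j => X w j)).
split=> [|c legal_c].
  by split=> [w|h j]; [exact: legal_wrap_strategy | move=> ? ? ?].
pose E := [set x : {ffun 'I_n -> 'I_n} |
  [forall i : 'I_m, #|wrapping n (fun j => x j) c i| <= p.+1]%N]%SET.
apply: (@le_trans _ _ (P (fun w => X w \in E))); last first.
  apply: le_measure; rewrite ?inE // => w; rewrite inE => /forallP small.
  apply: (backlog_wrap_le1 legal_c n0) => // i im.
  exact: (small (Ordinal im)).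
rewrite PX lee_fin ler_pdivlMr ?ltr0n; last first.
  by apply/card_gt0P; exists [ffun _ => Ordinal n0].
apply: le_trans (card_no_overflow n0 e0 e2 legal_c); rewrite ler_wpM2r // lerD2l lerN2.
apply: (le_trans (ler_wpM2r (expR_ge0 _) mle)); rewrite -expRD ler_expR; lra.
Qed.
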